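(* Let $n > k \geq 1$ be integers. If $\mathcal{F}$ is a $k$-pseudotree on an $n$-element set $X$, then $|\mathcal{F}| \leq (k+1)n - \frac{(k+1)k}{2}$. This bound is best possible: for all integers $n > k \geq 1$ there is a $k$-pseudotree on an $n$-element set with exactly $(k+1)n - \frac{(k+1)k}{2}$ members.
   Context: All sets are finite. Let $\mathcal{F}$ be a family (set) of subsets of a set $X$, partially ordered by inclusion. The center of $A \subseteq X$ (with respect to $\mathcal{F}$) is $\mathrm{C}(A) = \{x \in A \mid \text{for every } U \in \mathcal{F} \text{ with } x \in U,\ U \subseteq A \text{ or } A \subseteq U\}$. The family $\mathcal{F}$ is centered iff $\mathrm{C}(U) \neq \emptyset$ for every $U \in \mathcal{F}$. The family $\mathcal{F}$ is locally $k$-wide iff for every $x \in X$ every antichain (with respect to inclusion) of $\{U \in \mathcal{F} \mid x \in U\}$ has at most $k$ members. The family $\mathcal{F}$ is a $k$-pseudotree on $X$ iff $\mathcal{F}$ is centered, locally $k$-wide, $X \in \mathcal{F}$, and $\{x\} \in \mathcal{F}$ for every $x \in X$. *)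

(* Defs.v *)
From mathcomp Require Import all_boot.
Set Implicit Arguments.
Unset Strict Implicit.
Unset Printing Implicit Defensive.

(* The finite ground set X is the finite type T itself
   (X = [set: T]), and a family of subsets of X is F : {set {set T}}. *)

Definition center (T : finType) (F : {set {set T}}) (A : {set T}) : {set T} :=
  [set x in A | [forall U in F, (x \in U) ==> (U \subset A) || (A \subset U)]].

Definition centered (T : finType) (F : {set {set T}}) : Prop :=
  forall U : {set T}, U \in F -> center F U != set0.

Definition antichain (T : finType) (S : {set {set T}}) : Prop :=
  forall U V : {set T}, U \in S -> V \in S -> U \subset V -> U = V.

Definition locally_wide (T : finType) (k : nat) (F : {set {set T}}) : Prop :=
  forall (x : T) (S : {set {set T}}),
    S \subset [set U in F | x \in U] -> antichain S -> #|S| <= k.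

Definition pseudotree (T : finType) (k : nat) (F : {set {set T}}) : Prop :=
  [/\ centered F,
      locally_wide k F,
      [set: T] \in F
    & forall x : T, [set x] \in F].

(* Main.v *)
(** The upper bound is by induction on the number of points.  Call a point [x]
    removable if every member of [F] other than [{x}] has a central point
    different from [x].  Deleting a removable point from all members preserves
    centeredness and local width.  A non-central point of a minimal member with
    at least two elements is removable.  The deletion loses [{x}] and identifies
    [U] with [U :\ x] whenever both are members; such sets [U] form an antichain
    through [x], and their central points other than [x] are pairwise distinct,
    so at most [minn k n.-1] of them exist.  Equality is attained by the
    singletons together with the sets [{i} U {m+1, ..., n-1}] for
    [i <= m] and [i < k]. *)
Require Import Defs.
From mathcomp Require Import all_boot zify.

Set Implicit Arguments.
Unset Strict Implicit.
Unset Printing Implicit Defensive.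

Lemma centerP (T : finType) (F : {set {set T}}) (A : {set T}) x :
  reflect (x \in A /\
           forall U, U \in F -> x \in U -> (U \subset A) || (A \subset U))
          (x \in center F A).
Proof.
rewrite inE; apply: (iffP andP) => -[xA xP]; split=> //.
  by move=> U UF xU; have /forall_inP/(_ _ UF)/implyP := xP; apply.
by apply/forall_inP => U UF; apply/implyP => xU; apply: xP.
Qed.

(** * Deletion of a removable point *)

Definition removable (T : finType) (F : {set {set T}}) (x : T) : Prop :=
  forall U, U \in F -> U != [set x] -> exists2 c, c \in center F U & c != x.

Definition trace_del (T : finType) (F : {set {set T}}) (x : T) : {set {set T}} :=
  [set U :\ x | U in F :\ [set x]].

Definition twins (T : finType) (F : {set {set T}}) (x : T) : {set {set T}} :=
  [set U in F :\ [set x] | (x \in U) && (U :\ x \in F)].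

Section UpperBound.

Variable T : finType.
Implicit Types (F : {set {set T}}) (D : {set T}) (x : T) (k : nat).

Lemma set0_centered F : centered F -> set0 \notin F.
Proof.
move=> cF; apply/negP => /cF/set0Pn[c] /centerP[].
by rewrite inE.
Qed.

(** If all members are singletons, any point works. Otherwise take a smallest member [M] with at
    least two elements, [c] central in [M], and any [y] in [M] other than [c]: whenever [y] is
    central in a member [U] other than [[set y]], so is [c]. *)
Lemma removable_exists F D :
  centered F -> (forall U, U \in F -> U \subset D) -> D != set0 ->
  exists2 x, x \in D & removable F x.
Proof.
move=> cF FD /set0Pn[x0 x0D].
have [/existsP[M0 M0P]|noM] := boolP [exists M, (M \in F) && (1 < #|M|)]; last first.
  exists x0 => // U UF; have /set0Pn[c cU] := cF _ UF.
  have /centerP[cinU _] := cU.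
  have U1 : U = [set c].
    apply/eqP; rewrite eq_sym eqEcard sub1set cinU cards1 leqNgt.
    by apply/negP => U2; move/existsP: noM; apply; exists U; rewrite UF.
  move=> Ux; exists c => //; apply: contra Ux => /eqP <-; exact/eqP.
case: (@arg_minnP _ M0 (fun M => (M \in F) && (1 < #|M|))
  (fun M : {set T} => #|M|) M0P) => M /andP[MF M2] Mmin.
have /set0Pn[c cM] := cF _ MF; have /centerP[cinM cMP] := cM.
have /set0Pn[y] : M :\ c != set0.
  by rewrite -card_gt0; move: M2; rewrite (cardsD1 c) cinM.
rewrite !inE => /andP[yc yM].
exists y; first by apply: (subsetP (FD _ MF)).
move=> U UF Uy; have /set0Pn[d dU] := cF _ UF.
have [dy|dy] := eqVneq d y; last by exists d.
move: dU; rewrite {}dy => /centerP[yU yUP].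
(* Centrality of [y] in [U] makes [M] and [U] comparable, and minimality of [M] excludes a proper
   inclusion of [U] in [M]. *)
have MU : M \subset U.
  case/orP: (yUP _ MF yM) => // UM.
  have U2 : 1 < #|U|.
    rewrite ltnNge; apply/negP => U1; case/negP: Uy.
    by rewrite eq_sym eqEcard sub1set yU cards1.
  have /eqP <- // : U == M.
  by rewrite eqEcard UM; apply: Mmin; rewrite UF.
exists c; last by rewrite eq_sym.
apply/centerP; split; first exact: (subsetP MU).
(* Either [V] lies in [M], hence in [U], or it contains [M], hence the point [y], which is central
   in [U]. *)
move=> V VF cV; case/orP: (cMP _ VF cV) => [VM|MV].
  by rewrite (subset_trans VM MU).
by apply: yUP => //; apply: (subsetP MV).
Qed.

Lemma centered_trace F x : removable F x -> centered (trace_del F x).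
Proof.
move=> rx _ /imsetP[U /setD1P[Ux UF] ->].
have [c /centerP[cU cUP] cx] := rx _ UF Ux.
apply/set0Pn; exists c; apply/centerP; split; first by rewrite !inE cx.
move=> _ /imsetP[V /setD1P[_ VF] ->] /setD1P[_ cV].
by case/orP: (cUP _ VF cV) => S; rewrite (setSD _ S) ?orbT.
Qed.

Lemma locally_wide_trace k F x :
  locally_wide k F -> locally_wide k (trace_del F x).
Proof.
move=> wF z S SF aS.
(* An antichain of traces through [z] is lifted to chosen preimages; deleting [x] preserves
   inclusion, so the lifts again form an antichain through [z]. The default is never taken on
   [S]. *)
pose lift W := odflt set0 [pick U in F :\ [set x] | (U :\ x == W)].
have liftP W : W \in S -> [/\ lift W \in F, lift W :\ x = W & z \in lift W].
  move=> WS; have := subsetP SF _ WS; rewrite inE => /andP[/imsetP[U UF eW] zW].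
  rewrite /lift; case: pickP => [V /andP[/setD1P[_ VF] /eqP VW]|/(_ U)] /=.
    by split=> //; move: zW; rewrite -VW => /setD1P[].
  by rewrite UF eW eqxx.
rewrite -(@card_in_imset _ _ lift); last first.
  by move=> V W /liftP[_ eV _] /liftP[_ eW _] e; rewrite -eV -eW e.
apply: (wF z).
  by apply/subsetP => _ /imsetP[W /liftP[WF _ zW] ->]; rewrite inE WF.
move=> _ _ /imsetP[V VS ->] /imsetP[W WS ->] sVW.
congr lift; apply: aS => //.
have [_ eV _] := liftP _ VS; have [_ eW _] := liftP _ WS.
by rewrite -eV -eW; apply: setSD.
Qed.

(** Let [U] be contained in [V], and [c] be central in [U] with [c != x]. The member [V :\ x]
    contains [c] but not all of [U], so it lies in [U], and [U = V]. *)
Lemma antichain_twins F x : removable F x -> antichain (twins F x).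
Proof.
move=> rx U V; rewrite !inE => /and3P[/andP[Ux UF] xU _] /and3P[_ xV VxF] UV.
have [c /centerP[cU cUP] cx] := rx _ UF Ux.
have cVx : c \in V :\ x by rewrite !inE cx (subsetP UV).
case/orP: (cUP _ VxF cVx) => [VU|/subsetP/(_ _ xU)]; last by rewrite !inE eqxx.
apply/eqP; rewrite eqEsubset UV; apply/subsetP => v vV.
have [->//|vx] := eqVneq v x.
by apply: (subsetP VU); rewrite !inE vx.
Qed.

Lemma card_twins_wide k F x :
  locally_wide k F -> removable F x -> #|twins F x| <= k.
Proof.
move=> wF /antichain_twins aP; apply: (wF x) => //.
by apply/subsetP => U; rewrite !inE => /and3P[/andP[_ ->] ->].
Qed.

Lemma card_twins_points F D x :
  (forall U, U \in F -> U \subset D) -> removable F x ->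
  #|twins F x| <= #|D :\ x|.
Proof.
move=> FD rx.
pose f U := odflt x [pick c in center F U | c != x].
have fP U : U \in twins F x -> f U \in center F U /\ f U != x.
  case/setIdP => /setD1P[Ux UF] _; have [c cU cx] := rx _ UF Ux.
  rewrite /f; case: pickP => [d /andP[]//|/(_ c)].
  by rewrite cU cx.
have PF U : U \in twins F x -> U \in F by rewrite !inE => /and3P[/andP[]].
(* A common central point makes two members comparable, and comparable twins are equal. *)
rewrite -(@card_in_imset _ _ f); last first.
  move=> U V UP VP fUV.
  have [/centerP[_ cU] _] := fP _ UP; have [/centerP[cV _] _] := fP _ VP.
  rewrite fUV in cU.
  case/orP: (cU _ (PF _ VP) cV) => [VU|]; last exact: (antichain_twins rx).
  by apply/esym; apply: (antichain_twins rx).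
apply: subset_leq_card; apply/subsetP => _ /imsetP[U UP ->].
have [/centerP[fU _] fx] := fP _ UP.
by rewrite !inE fx (subsetP (FD _ (PF _ UP))).
Qed.

Lemma card_trace F x : #|F| <= (#|trace_del F x| + #|twins F x|).+1.
Proof.
pose F' := F :\ [set x].
pose A := [set U in F' | x \notin U]; pose B := [set U in F' | x \in U].
have injB : {in B &, injective (fun U => U :\ x)}.
  move=> U V; rewrite !inE => /andP[_ xU] /andP[_ xV] eUV.
  by rewrite -(setD1K xU) -(setD1K xV) eUV.
have FAB : #|F'| = #|A| + #|B|.
  rewrite -(cardsID B F') addnC; congr (_ + _); apply: eq_card => U; rewrite !inE.
    by case: (x \in U); case: (U \in F); case: (U == _).
  by case: (x \in U); case: (U \in F); case: (U == _).
have GAB : A :|: [set U :\ x | U in B] \subset trace_del F x.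
  rewrite subUset; apply/andP; split; apply/subsetP => U.
    rewrite inE => /andP[UF xU]; apply/imsetP; exists U => //.
    apply/setP => z; rewrite !inE; have [->|//] := eqVneq z x.
    exact: negbTE.
  by case/imsetP => V; rewrite inE => /andP[VF _] ->; apply: imset_f.
have IAB : A :&: [set U :\ x | U in B] \subset [set U :\ x | U in twins F x].
  apply/subsetP => U /setIP[UA /imsetP[V VB eV]].
  rewrite eV; apply: imset_f.
  by move: UA VB; rewrite eV !inE => /andP[/andP[_ ->] _] /andP[-> ->].
have FF' : #|F| <= #|F'|.+1 by rewrite (cardsD1 [set x] F) -add1n leq_add2r leq_b1.
apply: leq_trans FF' _.
(* Deletion fixes [A] and is injective on [B], so the only loss is the overlap of the two images,
   which comes from twins. *)
rewrite ltnS FAB -(card_in_imset injB) -cardsUI.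
apply: leq_add; first exact: subset_leq_card.
exact: leq_trans (subset_leq_card IAB) (leq_imset_card _ _).
Qed.

(** The ground set is a subset [D] of a fixed type, so that the induction can delete points without
    changing [T]. *)
Lemma card_centered_wide k F D :
  centered F -> locally_wide k F -> (forall U, U \in F -> U \subset D) ->
  #|F| <= \sum_(m < #|D|) minn k.+1 m.+1.
Proof.
move Dn : #|D| => n; elim: n => [|n IH] in F D Dn *; move=> cF wF FD.
  rewrite big_ord0 leqn0 cards_eq0; apply/eqP/setP => U; rewrite inE.
  apply/negP => UF; case/negP: (set0_centered cF).
  have := FD _ UF; move/eqP: Dn; rewrite cards_eq0 => /eqP ->.
  by rewrite subset0 => /eqP <-.
have [|x xD rx] := removable_exists cF FD; first by rewrite -card_gt0 Dn.
have Dx : #|D :\ x| = n by move: Dn; rewrite (cardsD1 x) xD => -[].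
have tD U : U \in trace_del F x -> U \subset D :\ x.
  by case/imsetP => V /setD1P[_ VF] ->; apply/setSD/FD.
have := IH _ _ Dx (centered_trace rx) (locally_wide_trace wF) tD.
(* The last point contributes at most [1 + minn k n = minn k.+1 n.+1], the last summand. *)
have := card_trace F x; have := card_twins_wide wF rx.
have := card_twins_points FD rx; rewrite Dx big_ord_recr /=.
lia.
Qed.

End UpperBound.

(** * Closed form of the bound *)

Lemma sum_minnS k n :
  k <= n -> \sum_(m < n) minn k.+1 m.+1 = (k + 1) * n - ((k + 1) * k) %/ 2.
Proof.
move=> kn; suff: \sum_(m < n) minn k.+1 m.+1 + 'C(k.+1, 2) = k.+1 * n.
  by rewrite bin2 /= -divn2 addn1 => <-; rewrite addnK.
(* With [n = k + d], each step in [d] adds a summand [k.+1]; for [d = 0] the sum is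
   [1 + ... + k]. *)
rewrite -(subnKC kn); elim: (n - k) => [|d IH]; last first.
  rewrite addnS big_ord_recr /= mulnS -IH (minn_idPl _) ?ltnS ?leq_addr //.
  by rewrite addnAC addnC.
rewrite addn0 bin2 /= (eq_bigr (fun m : 'I_k => m.+1)) => [|m _]; last first.
  by have := ltn_ord m; lia.
elim: k {kn} => [|k IH]; first by rewrite big_ord0.
rewrite big_ord_recr /=; move: (\sum_(_ < _) _) IH => s IH.
by nia.
Qed.

(** * The extremal family *)

Section Extremal.

Variables (k n : nat).
Hypothesis k_gt0 : 0 < k.

Definition comet (p : 'I_n.+1 * 'I_n.+1) : {set 'I_n.+1} :=
  [set j | (j == p.1) || (p.2 < j)].

(* The pairs [(i, ord_max)] encode the singletons. *)
Definition comet_index : {set 'I_n.+1 * 'I_n.+1} :=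
  [set p : 'I_n.+1 * 'I_n.+1 | (p.1 <= p.2) && ((p.1 < k) || (p.2 == ord_max))].

Definition comets : {set {set 'I_n.+1}} := comet @: comet_index.

Lemma comet_head p : p.1 \in comet p.
Proof. by rewrite inE eqxx. Qed.

Lemma comet_max i : comet (i, ord_max) = [set i].
Proof. by apply/setP => j; rewrite !inE /= ltnNge -ltnS ltn_ord orbF. Qed.

Lemma comet_sub (p q : 'I_n.+1 * 'I_n.+1) :
  p.1 \in comet q -> q.2 <= p.2 -> comet p \subset comet q.
Proof.
move=> pq qp; apply/subsetP => j; rewrite !inE => /orP[/eqP->|pj].
  by move: pq; rewrite inE.
by rewrite (leq_ltn_trans qp pj) orbT.
Qed.

Lemma comet_chain (p q : 'I_n.+1 * 'I_n.+1) :
  p.1 = q.1 -> (comet p \subset comet q) || (comet q \subset comet p).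
Proof.
move=> pq; case: (leqP q.2 p.2) => [|/ltnW] le.
  by rewrite comet_sub // pq comet_head.
by rewrite orbC comet_sub // -pq comet_head.
Qed.

(** If [comet q] contains [p.1], then either the heads agree and the two sets are nested, or
    [q.2 < p.1 <= p.2], which puts [comet p] inside [comet q]. *)
Lemma comet_head_center p : p \in comet_index -> p.1 \in center comets (comet p).
Proof.
rewrite inE => /andP[p12 _]; apply/centerP; split; first exact: comet_head.
move=> _ /imsetP[q _ ->] pq.
have [eqp|neqp] := eqVneq p.1 q.1; first by rewrite orbC comet_chain.
rewrite (comet_sub pq) ?orbT //.
move: pq; rewrite inE (negbTE neqp) /= => /ltnW qp.
exact: leq_trans p12.
Qed.

(** The head is the least element of the set, since [p.1 <= p.2]. For equal heads, [q.2 < p.2] would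
    put [p.2] into [comet q] but not into [comet p]. *)
Lemma comet_inj : {in comet_index &, injective comet}.
Proof.
suff le p q : p \in comet_index -> q \in comet_index -> comet p = comet q ->
    (q.1 <= p.1) && ((p.1 == q.1) ==> (p.2 <= q.2)).
  move=> p q pI qI e.
  case/andP: (le _ _ pI qI e) (le _ _ qI pI (esym e)) => qp1 pq2 /andP[pq1 qp2].
  have e1 : p.1 = q.1 by apply/val_inj/eqP; rewrite eqn_leq pq1.
  move: pq2 qp2; rewrite e1 eqxx /= => pq2 qp2.
  have e2 : p.2 = q.2 by apply/val_inj/eqP; rewrite eqn_leq pq2.
  by move: e1 e2; case: (p) (q) => ? ? [? ?] /= -> ->.
rewrite !inE => /andP[p12 _] /andP[q12 _] e; apply/andP; split.
  have := comet_head p; rewrite e inE => /orP[/eqP->//|/ltnW].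
  exact: leq_trans.
apply/implyP => /eqP e1; rewrite leqNgt; apply/negP => qp.
have : p.2 \in comet q by rewrite inE qp orbT.
rewrite -e inE ltnn orbF => /eqP p21.
by move: qp; rewrite p21 e1 ltnNge q12.
Qed.

(** An antichain through [x] containing [[set x]] has no other member. Otherwise all heads are below
    [k], and they are distinct because comets with a common head are nested. *)
Lemma locally_wide_comets : locally_wide k comets.
Proof.
move=> x S SF aS.
have inS U : U \in S -> U \in comets /\ x \in U.
  by move/(subsetP SF); rewrite inE => /andP[].
have [xS|xS] := boolP ([set x] \in S).
  have -> : S = [set [set x]].
    apply/setP => U; rewrite inE; apply/idP/eqP => [US|->//].
    by apply/esym/aS => //; rewrite sub1set; case: (inS _ US).
  by rewrite cards1.
pose idx U := odflt (ord0, ord0) [pick p in comet_index | comet p == U].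
have idxP U : U \in S -> [/\ idx U \in comet_index, comet (idx U) = U & (idx U).1 < k].
  move=> US; have [/imsetP[p pI eU] xU] := inS _ US.
  have [] : idx U \in comet_index /\ comet (idx U) = U.
    rewrite /idx; case: pickP => [q /andP[qI /eqP]//|/(_ p)] /=.
    by rewrite pI eU eqxx.
  case: (idx U) => i m iI eim; split=> //=.
  move: (iI); rewrite inE => /andP[_ /orP[//|/= /eqP em]].
  move: eim; rewrite em comet_max => eim.
  move: US xU; rewrite -eim => US /set1P exi.
  by case/negP: xS; rewrite exi.
pose head U : 'I_k := odflt (Ordinal k_gt0) (insub (val (idx U).1)).
have headP U : U \in S -> val (head U) = val (idx U).1.
  by case/idxP => _ _ lt; rewrite /head insubT.
rewrite -(@card_in_imset _ _ head); first by rewrite -[leqRHS]card_ord max_card.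
move=> U V US VS /(congr1 val); rewrite !headP // => /val_inj e.
have [_ eU _] := idxP _ US; have [_ eV _] := idxP _ VS.
case/orP: (comet_chain e); rewrite eU eV; first exact: aS.
by move=> ?; apply/esym/aS.
Qed.

Lemma pseudotree_comets : pseudotree k comets.
Proof.
split; [| exact: locally_wide_comets | |].
- by move=> _ /imsetP[p /comet_head_center cp ->]; apply/set0Pn; exists p.1.
(* Head 0 with tail [j > 0] is the whole set, and [0 < k] makes the pair an index. *)
- apply/imsetP; exists (ord0, ord0); first by rewrite inE /= k_gt0.
  by apply/setP => j; rewrite !inE /= -val_eqE /=; case: (val j).
- move=> x; apply/imsetP; exists (x, ord_max); last by rewrite comet_max.
  by rewrite inE /= eqxx orbT andbT -ltnS ltn_ord.
Qed.

Lemma card_comets : #|comets| = \sum_(m < n.+1) minn k.+1 m.+1.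
Proof.
have card_lt b : b <= n.+1 -> \sum_(i < n.+1 | i < b) 1 = b.
  by move=> bn; rewrite (big_ord_narrow bn) sum1_card card_ord.
rewrite (card_in_imset comet_inj) -sum1_card.
rewrite (eq_bigl (fun p : 'I_n.+1 * 'I_n.+1 =>
  xpredT p.1 && ((p.1 <= p.2) && ((p.1 < k) || (p.2 == ord_max))))); last first.
  by move=> p; rewrite inE.
rewrite -(pair_big_dep xpredT (fun i m : 'I_n.+1 =>
  (i <= m) && ((i < k) || (m == ord_max))) (fun _ _ => 1)) /=.
(* Pairs are counted by second coordinate [m]: all [n.+1] heads for [m = n], and [minn k m.+1] heads
   for [m < n]. *)
rewrite (exchange_big_dep xpredT) //= big_ord_recr /=.
rewrite (eq_bigl (fun i : 'I_n.+1 => i < n.+1)) => [|i]; last first.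
  by rewrite eqxx orbT andbT ltnS.
rewrite card_lt // (eq_bigr (fun m : 'I_n => minn k m.+1)) => [|m _]; last first.
  rewrite (eq_bigl (fun i : 'I_n.+1 => i < minn k m.+1)).
    by apply: card_lt; have := ltn_ord m; lia.
  move=> i; rewrite -val_eqE /= ltn_eqF // orbF; lia.
(* Splitting off the first summand 1 shifts the others to [minn k m.+1 + 1]; the ones add up to
   [n.+1]. *)
rewrite [RHS]big_ord_recl /=.
rewrite [in RHS](eq_bigr (fun m : 'I_n => minn k m.+1 + 1)) => [|m _]; last first.
  by rewrite /bump /=; lia.
by rewrite big_split /= sum1_card card_ord; lia.
Qed.

End Extremal.

Theorem theorem3p4p1 (n k : nat) (k_ge1 : 1 <= k) (k_lt_n : k < n) :
  (forall (T : finType) (F : {set {set T}}),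
     #|T| = n -> pseudotree k F ->
     #|F| <= (k + 1) * n - ((k + 1) * k) %/ 2) /\
  (exists (T : finType) (F : {set {set T}}),
     [/\ #|T| = n, pseudotree k F
       & #|F| = (k + 1) * n - ((k + 1) * k) %/ 2]).
Proof.
rewrite -(sum_minnS (ltnW k_lt_n)); split=> [T F Tn [cF wF _ _]|].
  by rewrite -Tn -cardsT; apply: card_centered_wide => // U _; apply: subsetT.
case: n k_lt_n => // n _.
exists 'I_n.+1, (comets k n); split; first exact: card_ord.
  exact: pseudotree_comets.
exact: card_comets.
Qed.
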